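(* Let $X$ be an infinite-dimensional complex Banach space and let $T$ be a bounded linear operator on $X$. Then $T$ is left generalized Drazin invertible if and only if $T$ admits a generalized Kato decomposition $(M,N)$ such that the restriction $T_M$ has the single-valued extension property at $0$.
   Context: $\mathcal{L}(X)$ is the algebra of bounded linear operators on $X$; $T_M$ denotes the restriction of $T$ to a $T$-invariant closed subspace $M$, regarded as an operator on $M$. The quasinilpotent part of $T$ is $H_0(T)=\{x\in X:\lim_{n\to\infty}\|T^nx\|^{1/n}=0\}$. $T\in\mathcal{L}(X)$ is left generalized Drazin invertible if $H_0(T)$ is closed and there is a closed subspace $M$ of $X$ with $X=M\oplus H_0(T)$, $T(M)\subset M$ and $T(M)$ closed. An operator $S$ is semi-regular if its range $R(S)$ is closed and $N(S^n)\subseteq R(S)$ for all $n\in\mathbb{N}$, where $N(\cdot)$ is the null space. A pair $(M,N)$ of closed subspaces is a generalized Kato decomposition (GKD) of $T$ if $X=M\oplus N$, $T(M)\subset M$, $T(N)\subset N$, $T_M$ is semi-regular and $T_N$ is quasinilpotent. An operator $S$ on a Banach space $Y$ has the single-valued extension property (SVEP) at $\lambda_0\in\mathbb{C}$ if for every connected open neighborhood $\mathcal{U}$ of $\lambda_0$ the only analytic function $f:\mathcal{U}\to Y$ satisfying $(\lambda I-S)f(\lambda)=0$ for all $\lambda\in\mathcal{U}$ is $f\equiv 0$. *)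

(* Defs.v *)
From HB Require Import structures.
From mathcomp Require Import all_boot all_order all_algebra.
From mathcomp Require Import all_classical all_reals all_analysis.
From mathcomp Require Import complex.
Set Implicit Arguments.
Unset Strict Implicit.
Unset Printing Implicit Defensive.
Import Order.TTheory GRing.Theory Num.Theory.
Import numFieldNormedType.Exports.
Local Open Scope classical_set_scope.
Local Open Scope ring_scope.

(* R[i] is a numFieldType, but the topology that mathcomp-analysis puts on every
   numFieldType is otherwise found for R[i] only through R[i]^o. *)
HB.instance Definition _ (R : realType) := NormedModule.copy R[i] R[i]^o.

Section Spaces.
Variables (R : realType) (X : normedModType R[i]).

(* `|x| lives in R[i]; it is a nonnegative real, so Re loses nothing. *)
Definition normR (x : X) : R := complex.Re `|x|.

Definition finite_dimensional : Prop :=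
  exists (n : nat) (e : 'I_n -> X),
    forall x, exists c : 'I_n -> R[i], x = \sum_(i < n) c i *: e i.

Record bounded_operator := BoundedOperator {
  op_fun :> {linear X -> X};
  op_bounded : exists K : R, forall x, normR (op_fun x) <= K * normR x }.

Record closed_subspace := ClosedSubspace {
  subspace_set :> set X;
  subspace_submod : submod_closed [pred x | x \in subspace_set];
  subspace_closed : closed subspace_set }.

Definition direct_sum (A B : set X) : Prop :=
  (forall x, exists a b, [/\ A a, B b & x = a + b]) /\ A `&` B = [set 0].

Definition invariant (T : bounded_operator) (M : closed_subspace) : Prop :=
  T @` M `<=` M.

End Spaces.

Section SubspaceType.
Variables (R : realType) (X : normedModType R[i]) (M : closed_subspace X).

(* A closed subspace as a normed space of its own, with the norm of X. *)
Definition subspace_type : Type := {x : X | x \in subspace_set M}.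

HB.instance Definition _ := Choice.on subspace_type.
HB.instance Definition _ := SubType.on subspace_type.
HB.instance Definition _ := GRing.SubChoice_isSubLmodule.Build
  R[i] X [pred x | x \in subspace_set M] subspace_type (subspace_submod M).

Definition sub_norm (u : subspace_type) : R[i] := `|val u|.

Fact sub_normD u v : sub_norm (u + v) <= sub_norm u + sub_norm v.
Proof. by rewrite /sub_norm raddfD ler_normD. Qed.

Fact sub_normZ (l : R[i]) u : sub_norm (l *: u) = `|l| * sub_norm u.
Proof. by rewrite /sub_norm linearZ normrZ. Qed.

Fact sub_norm0_eq0 u : sub_norm u = 0 -> u = 0.
Proof. by move/normr0_eq0 => u0; apply/val_inj; rewrite u0 raddf0. Qed.

HB.instance Definition _ := Lmodule_isNormed.Build
  R[i] subspace_type sub_normD sub_normZ sub_norm0_eq0.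

End SubspaceType.

Section Restriction.
Variables (R : realType) (X : normedModType R[i]) (T : bounded_operator X).
Variables (M : closed_subspace X) (TM : invariant T M).

Fact restr_subproof (u : subspace_type M) : T (val u) \in subspace_set M.
Proof. by apply/mem_set/TM; exists (val u) => //; apply/set_mem/(valP u). Qed.

Definition restr_fun (u : subspace_type M) : subspace_type M :=
  Sub (T (val u)) (restr_subproof u).

Fact restr_linear : linear restr_fun.
Proof. by move=> a u v; apply/val_inj; rewrite /= !linearP. Qed.

HB.instance Definition _ := GRing.isLinear.Build
  R[i] (subspace_type M) (subspace_type M) _ restr_fun restr_linear.

Fact restr_bounded :
  exists K : R, forall u, normR (restr_fun u) <= K * normR u.
Proof. by have [K TK] := op_bounded T; exists K => u; apply: TK. Qed.

Definition restr : bounded_operator (subspace_type M) :=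
  BoundedOperator restr_bounded.

End Restriction.

Section OperatorNotions.
Variables (R : realType) (Y : normedModType R[i]).

Definition op_norm (f : Y -> Y) : R :=
  sup [set normR (f y) | y in [set y | normR y <= 1]].

Definition quasinilpotent_part (S : bounded_operator Y) : set Y :=
  [set y | (fun n => normR (iter n S y) `^ n%:R^-1) @ \oo --> (0 : R)].

Definition quasinilpotent (S : bounded_operator Y) : Prop :=
  (fun n => op_norm (iter n S) `^ n%:R^-1) @ \oo --> (0 : R).

Definition null_space (f : Y -> Y) : set Y := [set y | f y = 0].

Definition semi_regular (S : bounded_operator Y) : Prop :=
  closed (range S) /\ forall n, null_space (iter n S) `<=` range S.

(* Only the values of f on U matter; each point of U has a neighborhood on
   which f is the sum of a convergent power series with coefficients in Y. *)
Definition analytic_on (U : set R[i]) (f : R[i] -> Y) : Prop :=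
  forall z0, U z0 -> exists a : nat -> Y,
    \forall z \near z0,
      series (fun n => (z - z0 : R[i]) ^+ n *: a n) @ \oo --> f z.

Definition svep_at (S : bounded_operator Y) (l0 : R[i]) : Prop :=
  forall U : set R[i], open U -> connected U -> U l0 ->
  forall f : R[i] -> Y, analytic_on U f ->
    (forall l, U l -> l *: f l - S (f l) = 0) ->
    forall l, U l -> f l = 0.

End OperatorNotions.

Section MainNotions.
Variables (R : realType) (X : normedModType R[i]) (T : bounded_operator X).

Definition left_generalized_Drazin_invertible : Prop :=
  closed (quasinilpotent_part T) /\
  exists M : closed_subspace X,
    [/\ direct_sum M (quasinilpotent_part T), invariant T M & closed (T @` M)].

Record generalized_Kato_decomposition := GKD {
  gkd_M : closed_subspace X;
  gkd_N : closed_subspace X;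
  gkd_sum : direct_sum gkd_M gkd_N;
  gkd_invM : invariant T gkd_M;
  gkd_invN : invariant T gkd_N;
  gkd_semi_regular : semi_regular (restr gkd_invM);
  gkd_quasinilpotent : quasinilpotent (restr gkd_invN) }.

End MainNotions.

Arguments gkd_invM {R X T} _.
Arguments gkd_invN {R X T} _.

(* Main.v *)
Require Import Defs.
From HB Require Import structures.
From mathcomp Require Import all_boot all_order all_algebra.
From mathcomp Require Import all_classical all_reals all_analysis.
From mathcomp Require Import complex.
From mathcomp Require Import ring lra.
Import Order.TTheory GRing.Theory Num.Theory.
Import numFieldNormedType.Exports.
Local Open Scope classical_set_scope.
Local Open Scope ring_scope.

Set Implicit Arguments.
Unset Strict Implicit.
Unset Printing Implicit Defensive.

(** Write H for the quasinilpotent part of T.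

    For an operator S with closed range, open mapping provides preimages
    x of each y in the range with |x| <= C |y| (closed_range_lift).
    This single estimate is used twice.

    - If S is moreover injective, then |S^n y| >= C^-n |y|, so that only y = 0
      satisfies |S^n y|^(1/n) -> 0 (injective_quasinilpotent_part).
    - If S is semi-regular and S x = 0 with x <> 0, iterating the lifting gives
      x = u 0, S (u n.+1) = u n with |u n| <= C^n |x|; the inclusions
      N(S^n) <= R(S) are what allows the lifting to go on. The sum f z of the
      z^n u n is analytic near 0, satisfies (z - S) f z = 0 and f 0 = x, and
      contradicts the SVEP at 0. So semi-regularity and SVEP at 0 imply
      injectivity (svep_injective). Conversely an injective operator has the
      SVEP at 0: the Taylor coefficients at 0 of a solution vanish one after
      the other, and the identity theorem does the rest (injective_svep).

    Suppose now that X = M (+) H with H closed and T(M) closed. The kernel of T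
    lies in H, hence T is injective on M: T_M is semi-regular, with the SVEP
    at 0. All the vectors of the Banach space H are quasinilpotent for T, and
    by the uniform boundedness principle so is the operator T_H
    (pointwise_quasinilpotent). So (M, H) is the desired decomposition.

    Conversely let (M, N) be a generalized Kato decomposition such that T_M has
    the SVEP at 0. Then N is contained in H, T_M is injective with closed range,
    thus M meets H only at 0; since X = M (+) N this forces H = N, which is
    closed, while T(M) is closed as the range of T_M.

    Both open mapping and uniform boundedness are instances of one statement:
    on a Banach space a countably subadditive seminorm with finite values is
    bounded (Zabreiko's lemma, gauge_bounded). *)

(** * Norms and limits with real values *)

Section RealNorm.
Variables (R : realType) (Y : normedModType R[i]).
Implicit Types (x y : Y) (a z : R[i]).

Lemma normRE x : `|x| = (normR x)%:C%C.
Proof. by rewrite /normR RRe_real// normr_real. Qed.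

Lemma normR_ge0 x : 0 <= normR x.
Proof. by rewrite -ler0c -normRE. Qed.

Lemma normR0 : normR (0 : Y) = 0.
Proof. by rewrite /normR normr0. Qed.

Lemma normR_eq0 x : normR x = 0 -> x = 0.
Proof. by move=> x0; apply/normr0_eq0; rewrite normRE x0. Qed.

Lemma normR_gt0 x : x <> 0 -> 0 < normR x.
Proof.
by move=> x0; rewrite lt_def normR_ge0 andbT; apply/eqP => /normR_eq0.
Qed.

Lemma normRN x : normR (- x) = normR x.
Proof. by rewrite /normR normrN. Qed.

Lemma normRD x y : normR (x + y) <= normR x + normR y.
Proof. by rewrite -lecR rmorphD/= -!normRE ler_normD. Qed.

Lemma normRB x y : normR (x - y) <= normR x + normR y.
Proof. by rewrite -[leRHS](congr1 _ (normRN y)) normRD. Qed.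

Lemma normR_distC x y : normR (x - y) = normR (y - x).
Proof. by rewrite -normRN opprB. Qed.

Lemma normR_triangle (t x y : Y) :
  normR (x - y) <= normR (x - t) + normR (t - y).
Proof. by rewrite -[in leLHS](subrK t x) -addrA normRD. Qed.

Lemma normR_sum (n : nat) (F : nat -> Y) :
  normR (\sum_(0 <= k < n) F k) <= \sum_(0 <= k < n) normR (F k).
Proof.
elim: n => [|n IH]; first by rewrite !big_nil normR0.
by rewrite !big_nat_recr//= (le_trans (normRD _ _))// lerD2r.
Qed.

End RealNorm.

Section ScalarNorm.
Variable R : realType.
Implicit Types (a z : R[i]) (r : R).

Lemma normRZ (Y : normedModType R[i]) a (y : Y) :
  normR (a *: y) = normR a * normR y.
Proof.
by apply: complexI; rewrite rmorphM/= -!normRE normrZ.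
Qed.

Lemma normRM a z : normR (a * z) = normR a * normR z.
Proof. exact: (normRZ (Y := R[i])). Qed.

Lemma normR_real r : normR (r%:C)%C = `|r|.
Proof. by rewrite /normR normc_def/= expr0n addr0 sqrtr_sqr. Qed.

Lemma normR1 : normR (1 : R[i]) = 1.
Proof. by rewrite (normR_real 1) normr1. Qed.

Lemma normRX a n : normR (a ^+ n) = normR a ^+ n.
Proof. by elim: n => [|n IH]; rewrite ?expr0 ?normR1// !exprS normRM IH. Qed.

Lemma normRV a : normR a^-1 = (normR a)^-1.
Proof.
have [->|a0] := eqVneq a 0; first by rewrite invr0 normR0 invr0.
have Na0 : normR a != 0 by apply: contra_neq a0; exact: normR_eq0.
by apply: (mulfI Na0); rewrite -normRM !mulfV// normR1.
Qed.

End ScalarNorm.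

Section RealTopology.
Variables (R : realType) (Y : normedModType R[i]).
Implicit Types (x y : Y) (u : nat -> Y).

(** The canonical radii are positive elements of the complex field, which is only
    partially ordered; this lemma and the next ones replace them by real ones. *)
Lemma nbhs_normRP y (A : set Y) :
  nbhs y A <-> exists2 r : R, 0 < r & forall x, normR (x - y) < r -> A x.
Proof.
split=> [/nbhs_normP[e e0 eA]|[r r0 rA]].
  have er : (complex.Re e)%:C%C = e by rewrite RRe_real// gtr0_real.
  exists (complex.Re e); first by rewrite -ltcR er.
  by move=> x xy; apply: eA => /=; rewrite distrC normRE -er ltcR.
apply/nbhs_normP; exists r%:C%C; first by rewrite /= ltcR.
by move=> x /=; rewrite distrC normRE ltcR; apply: rA.
Qed.

Lemma cvg_normRP u y :
  u @ \oo --> y <->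
  forall e : R, 0 < e -> exists N, forall n, (N <= n)%N -> normR (u n - y) < e.
Proof.
split=> [uy e e0|uy A /nbhs_normRP[r r0 rA]].
  have /uy[N _ NA] : nbhs y [set x | normR (x - y) < e].
    by apply/nbhs_normRP; exists e.
  by exists N => n /NA.
have [N NA] := uy r r0.
by exists N => // n /= /NA; apply: rA.
Qed.

Lemma cvg_normR_squeeze u y (v : nat -> R) :
  (forall n, normR (u n - y) <= v n) -> v @ \oo --> (0 : R) -> u @ \oo --> y.
Proof.
move=> uv /cvgrPdist_lt v0; apply/cvg_normRP => e /v0[N _ Nv].
exists N => n /Nv /=; rewrite sub0r normrN; apply: le_lt_trans.
exact: le_trans (uv n) (ler_norm _).
Qed.

Lemma cvg_normR u y : u @ \oo --> y -> (fun n => normR (u n)) @ \oo --> normR y.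
Proof.
move=> /cvg_normRP uy; apply/cvgrPdist_lt => e /uy[N Nu].
exists N => // n /Nu; apply: le_lt_trans; rewrite ler_norml /=.
have := normRD (u n - y) y; have := normRD (y - u n) (u n).
by rewrite !subrK (normR_distC y); lra.
Qed.

Lemma cvg_normR_le u y (c : R) :
  u @ \oo --> y -> (\forall n \near \oo, normR (u n) <= c) -> normR y <= c.
Proof.
move=> /cvg_normR uy uc.
exact: (closed_cvg (fun r => r <= c) (@closed_le _ c) uc _ uy).
Qed.

Lemma closed_normRP (A : set Y) :
  closed A <->
  forall y, (forall e : R, 0 < e -> exists2 x, A x & normR (x - y) < e) -> A y.
Proof.
split=> [cA y yA|yA].
  by apply: cA => B /nbhs_normRP[r /yA[x Ax xr] rB]; exists x; split => //; exact: rB.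
move=> y cy; apply: yA => e e0.
have /cy[x [Ax xe]] : nbhs y [set x | normR (x - y) < e].
  by apply/nbhs_normRP; exists e.
by exists x.
Qed.

End RealTopology.

Section Completeness.
Variables (R : realType).

Lemma cauchy_normR (Y : completeNormedModType R[i]) (u : nat -> Y) :
  (forall e : R, 0 < e ->
    exists N, forall n, (N <= n)%N -> normR (u n - u N) < e) ->
  exists y : Y, u @ \oo --> y.
Proof.
move=> cu; suff uc : cvg (u @ \oo) by exists (lim (u @ \oo)).
apply: cauchy_cvg; apply: cauchy_exP => e e0.
have er : (complex.Re e)%:C%C = e by rewrite RRe_real// gtr0_real.
have [N Nu] : exists N, forall n, (N <= n)%N -> normR (u n - u N) < complex.Re e.
  by apply: cu; rewrite -ltcR er.
exists (u N), N => // n /= /Nu.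
by rewrite -ball_normE /ball_/= distrC normRE -er ltcR.
Qed.

Variables (X : completeNormedModType R[i]) (M : closed_subspace X).

(** Closed subspaces inherit completeness, so that the theorems on Banach spaces
    apply to restrictions of operators and to closed ranges. *)
Fact subspace_complete (F : set_system (subspace_type M)) :
  ProperFilter F -> cauchy F -> cvg F.
Proof.
move=> FF cF; pose G := [set A : set X | F (val @^-1` A)].
have GF : ProperFilter G := fmap_proper_filter _ FF.
have /cauchy_cvg/cvg_ex[x Gx] : cauchy G.
  apply: cauchy_exP => e e0; have /cauchyP/(_ e e0)[u Fu] := cF.
  exists (val u); apply: filterS Fu => v; rewrite -!ball_normE; exact.
have Mx : x \in subspace_set M.
  have FM : \forall u \near F, subspace_set M (val u).
    by apply: nearW => u; apply/set_mem/(valP u).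
  exact/mem_set/(closed_cvg _ (@subspace_closed _ _ M) FM _ Gx).
apply/cvg_ex; exists (Sub x Mx : subspace_type M) => A /nbhs_normP[e e0 eA].
have /Gx Fx : nbhs x (ball_ Num.norm x e) by apply/nbhs_normP; exists e.
have {}Fx : F (val @^-1` ball_ Num.norm x e) := Fx.
by apply: filterS Fx => u; apply: eA.
Qed.

HB.instance Definition _ :=
  Uniform_isComplete.Build (subspace_type M) subspace_complete.

End Completeness.

(** * Series dominated by a geometric series *)

Section Geometric.
Variable R : realType.

Lemma geometric_small (q A e : R) : 0 <= q < 1 -> 0 < e ->
  exists N, forall n, (N <= n)%N -> A * q ^+ n < e.
Proof.
move=> /andP[q0 q1] e0; have aq : `|q| < 1 by rewrite ger0_norm.
have /cvgrPdist_lt/(_ e e0)[N _ Nh] : (fun n => A * q ^+ n) @ \oo --> (0 : R).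
  by rewrite -(mulr0 A); apply: cvgMr; apply: cvg_expr.
by exists N => n /Nh; rewrite /= sub0r normrN ltr_norml => /andP[].
Qed.

Lemma half_exp_small (A e : R) : 0 < e -> exists N, A * 2^-1 ^+ N < e.
Proof.
move=> e0; have [|N Ne] := @geometric_small 2^-1 A e _ e0; first by lra.
by exists N; apply: Ne.
Qed.

Lemma geometric_sum_le (q : R) (N n : nat) : 0 <= q < 1 ->
  \sum_(N <= k < n) q ^+ k <= q ^+ N / (1 - q).
Proof.
move=> /andP[q0 q1]; have q10 : 0 < 1 - q by rewrite subr_gt0.
have [nN|Nn] := leqP n N.
  by rewrite big_geq// divr_ge0 ?exprn_ge0// ltW.
rewrite ler_pdivlMr//; suff -> : (\sum_(N <= k < n) q ^+ k) * (1 - q) = q ^+ N - q ^+ n.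
  by rewrite gerBl exprn_ge0.
have /= tel := telescope_sumr (fun k => q ^+ k) (ltnW Nn).
rewrite -[RHS]opprB -tel -sumrN big_distrl/=.
by apply: eq_bigr => k _; rewrite exprS; ring.
Qed.

Lemma series_geometric_tail (Y : normedModType R[i]) (u : nat -> Y) (c q : R)
    (N n : nat) : 0 <= q < 1 -> (N <= n)%N ->
    (forall k, normR (u k) <= c * q ^+ k) ->
  normR (series u n - series u N) <= c * q ^+ N / (1 - q).
Proof.
move=> q01 Nn uc; have c0 : 0 <= c.
  by have := uc 0%N; rewrite expr0 mulr1; apply: le_trans (normR_ge0 _).
have -> : series u n - series u N = \sum_(0 <= k < n - N) u (k + N)%N.
  by rewrite sub_series_geq// -{1}(add0n N) big_addn.
rewrite (le_trans (normR_sum _ (fun k => u (k + N)%N)))//.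
have -> : c * q ^+ N / (1 - q) = c * (q ^+ N / (1 - q)) by rewrite mulrA.
apply: le_trans (_ : c * \sum_(N <= k < n) q ^+ k <= _); last first.
  by rewrite ler_wpM2l// geometric_sum_le.
have -> : \sum_(N <= k < n) q ^+ k = \sum_(0 <= k < n - N) q ^+ (k + N)%N.
  by rewrite -{1}(add0n N) big_addn.
by rewrite mulr_sumr ler_sum_nat.
Qed.

Lemma series_geometric_cvg (Y : completeNormedModType R[i]) (u : nat -> Y)
    (c q : R) : 0 <= q < 1 -> (forall k, normR (u k) <= c * q ^+ k) ->
  exists2 y : Y, series u @ \oo --> y & normR y <= c / (1 - q).
Proof.
move=> q01 uc; have [y uy] : exists y : Y, series u @ \oo --> y.
  apply: cauchy_normR => e e0.
  have [N Ne] := geometric_small (c / (1 - q)) q01 e0.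
  exists N => n Nn; have := series_geometric_tail q01 Nn uc.
  by move/le_lt_trans; apply; rewrite mulrAC; exact: Ne.
exists y => //; apply: (cvg_normR_le uy); apply: nearW => n.
have := series_geometric_tail q01 (leq0n n) uc.
by rewrite [series u 0](big_geq (leqnn 0)) subr0 expr0 mulr1.
Qed.

End Geometric.

(** * Zabreiko's lemma *)

Section Gauge.
Variables (R : realType) (Y : completeNormedModType R[i]).

(** Baire's theorem for a countable cover of a Banach space: otherwise each A n
    could be avoided by a ball inside any given ball, and the nested balls
    obtained in this way would shrink to a point outside all the A n. *)
Lemma baire_cover (A : nat -> set Y) : (forall y, exists n, A n y) ->
  exists n y r, 0 < r /\ forall x, normR (x - y) < r ->
    forall s : R, 0 < s -> exists2 w, A n w & normR (w - x) <= s.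
Proof.
move=> covA; apply: contrapT => noball.
have step (nb : nat * (Y * R)) : exists b : Y * R, 0 < nb.2.2 ->
    [/\ 0 < b.2, b.2 <= nb.2.2 / 2, normR (b.1 - nb.2.1) + b.2 <= nb.2.2 &
      forall w, normR (w - b.1) <= b.2 -> ~ A nb.1 w].
  case: nb => n [y r] /=; apply: contrapT => nob; apply: noball.
  exists n, y, r; split.
    by apply: contrapT => r0; apply: nob; exists (0, 0) => /r0.
  move=> x xr s s0; apply: contrapT => now; apply: nob.
  (* The new ball has to avoid A n, to fit in the old one and to have at most
     half of its radius. *)
  pose t := Num.min s (Num.min (r - normR (x - y)) (r / 2)).
  exists (x, t) => /= r0; have t0 : 0 < t by rewrite !lt_min s0 subr_gt0 xr/=; lra.
  have [ts tr tr2] : [/\ t <= s, t <= r - normR (x - y) & t <= r / 2].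
    by rewrite !ge_min !lexx !orbT.
  split=> //; first by lra.
  by move=> w wt Aw; apply: now; exists w => //; apply: le_trans ts.
have [f fP] := choice step.
pose fix b n := if n is p.+1 then f (p, b p) else (0 : Y, 1 : R).
have b0 n : 0 < (b n).2.
  by elim: n => [|n /(fP (n, b n))[]//]; rewrite /= ltr01.
have bS n := fP (n, b n) (b0 n).
have b_small n : (b n).2 <= 1 * 2^-1 ^+ n.
  elim: n => [|n IH] /=; first by rewrite expr0 mulr1.
  have [_ bn _ _] := bS n; apply: (le_trans bn); rewrite exprSr mulrA.
  by rewrite ler_wpM2r// invr_ge0 ler0n.
have b_nest n m : (n <= m)%N -> normR ((b m).1 - (b n).1) + (b m).2 <= (b n).2.
  move=> /subnKC <-; elim: (m - n)%N => [|k IH].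
    by rewrite addn0 subrr normR0 add0r.
  rewrite addnS /=; have [_ _ + _] := bS (n + k)%N => /=.
  have := normR_triangle (b (n + k)%N).1 (f ((n + k)%N, b (n + k)%N)).1 (b n).1.
  by lra.
have [y by_] : exists y : Y, (fun n => (b n).1) @ \oo --> y.
  apply: cauchy_normR => e e0; have [N Ne] := half_exp_small 1 e0.
  exists N => n Nn; have := b_nest _ _ Nn; have := b0 n; have := b_small N.
  by lra.
have [n An] := covA y.
have [_ _ _ /(_ y) noA] := bS n; apply: noA An.
rewrite -/(b n.+1); apply: (@cvg_normR_le _ _ (fun m => (b m).1 - (b n.+1).1)).
  by apply: cvgB => //; apply: cvg_cst.
exists n.+1 => // m /= nm; have := b_nest _ _ nm; have := b0 m; lra.
Qed.

(** P c y stands for p y <= c, where p is a countably subadditive seminorm. The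
    relational form spares suprema and infima: p need not attain its values and
    only upper bounds for p ever matter. *)
Variable P : R -> Y -> Prop.
Hypothesis P_le : forall c d y, c <= d -> P c y -> P d y.
Hypothesis PB : forall c d x y, P c x -> P d y -> P (c + d) (x - y).
Hypothesis PZ : forall a c y, P c y -> P (normR (a : R[i]) * c) (a *: y).
Hypothesis P_fin : forall y, exists c, P c y.
Hypothesis P_series : forall c u y,
  (forall k, P (c * 2^-1 ^+ k) (u k)) -> series u @ \oo --> y -> P (2 * c) y.

(** By Baire's theorem some sublevel set of p is dense in a ball; differences of
    its points are dense in a ball around 0. So each small x is approximated by a
    point of a sublevel set, the error by a point of a sublevel set half as
    large, and so on: x is the sum of a series to which countable subadditivity
    applies. This is the successive approximation of the open mapping theorem. *)
Lemma gauge_bounded : exists2 C : R, 0 < C & forall y, P (C * normR y) y.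
Proof.
have P0 : P 0 0.
  by have [c /(@PZ 0)] := P_fin 0; rewrite normR0 mul0r scale0r.
have [n [y0 [r [r0 ball_dense]]]] : exists n y r, 0 < r /\
    forall x, normR (x - y) < r -> forall s : R, 0 < s ->
      exists2 w, P n%:R w & normR (w - x) <= s.
  apply: (@baire_cover (fun n y => P n%:R y)) => y; have [c Pc] := P_fin y.
  exists (Num.truncn c).+1; apply: P_le Pc; apply/ltW/truncnS_gt.
pose D : R := 2 * n%:R.
have D0 : 0 <= D by rewrite mulr_ge0 ?ler0n.
have dense0 x s : normR x < r -> 0 < s -> exists2 w, P D w & normR (w - x) <= s.
  move=> xr s0; have s20 : 0 < s / 2 by lra.
  have [|w1 Pw1 w1x] := ball_dense (x + y0) _ _ s20; first by rewrite addrK.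
  have [|w2 Pw2 w2x] := ball_dense y0 _ _ s20; first by rewrite subrr normR0.
  exists (w1 - w2); first by rewrite /D mulr_natl mulr2n; apply: PB.
  have -> : w1 - w2 - x = (w1 - (x + y0)) - (w2 - y0).
    by rewrite opprB opprD !addrA addrAC (addrAC _ (- y0)) subrK addrAC.
  by have := normRB (w1 - (x + y0)) (w2 - y0); lra.
have approx (kx : nat * Y) : exists w, normR kx.2 < r * 2^-1 ^+ kx.1 ->
    P (D * 2^-1 ^+ kx.1) w /\ normR (kx.2 - w) < r * 2^-1 ^+ kx.1.+1.
  case: kx => k x /=; pose q : R := 2 ^+ k.
  have q0 : 0 < q by rewrite exprn_gt0.
  have hq : 2^-1 ^+ k = q^-1 by rewrite exprVn.
  have [xr|xr] := ltP (normR x) (r * 2^-1 ^+ k); last by exists 0.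
  have cq (t : R[i]) : t = (q%:C)%C -> normR t = q.
    by move=> ->; rewrite normR_real gtr0_norm.
  have qC0 : (q%:C)%C != 0 :> R[i].
    by apply/eqP => /complexI q00; rewrite q00 ltxx in q0.
  (* Rescale by 2^k, approximate within r / 4, and scale back. *)
  have [||w Pw wx] := @dense0 ((q%:C)%C *: x) (r / 4).
  - by rewrite normRZ cq// mulrC -ltr_pdivlMr// -hq.
  - by lra.
  exists ((q%:C)%C^-1 *: w) => _; split.
    by have := PZ (q%:C)%C^-1 Pw; rewrite normRV cq// hq mulrC.
  have -> : x - (q%:C)%C^-1 *: w = (q%:C)%C^-1 *: ((q%:C)%C *: x - w).
    by rewrite scalerBr scalerA mulVf// scale1r.
  rewrite normRZ normRV cq// normR_distC exprSr hq mulrA -mulrA mulrCA.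
  by rewrite ltr_pM2l ?invr_gt0//; lra.
have [g gP] := choice approx.
have small x : normR x < r -> P (2 * D) x.
  move=> xr; pose fix rem k := if k is p.+1 then rem p - g (p, rem p) else x.
  have remP k : normR (rem k) < r * 2^-1 ^+ k.
    by elim: k => [|k /(gP (k, rem k))[]//]; rewrite expr0 mulr1.
  apply: (@P_series D (fun k => g (k, rem k))) => [k|].
    by have [] := gP (k, rem k) (remP k).
  have sumE k : series (fun k => g (k, rem k)) k = x - rem k.
    elim: k => [|k IH]; first by rewrite seriesEnat/= big_nil subrr.
    by rewrite seriesEnat/= big_nat_recr//= -[X in X + _]/(series _ k) IH opprB addrA addrAC.
  apply/cvg_normRP => e e0; have [N Ne] := half_exp_small r e0.
  exists N => k Nk; rewrite sumE addrAC subrr add0r normRN.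
  apply: lt_trans Ne; apply: (lt_le_trans (remP k)).
  rewrite ler_pM2l// ler_wiXn2l//; lra.
exists (4 * (D + 1) / r); first by rewrite divr_gt0//; lra.
move=> y; have [->|/eqP/normR_gt0 y0_gt0] := eqVneq y 0; first by rewrite normR0 mulr0.
pose t : R := 2 * normR y / r.
have t0 : 0 < t by rewrite divr_gt0// mulr_gt0.
have tC0 : (t%:C)%C != 0 :> R[i].
  by apply/eqP => /complexI t00; rewrite t00 ltxx in t0.
have nt : normR (t%:C)%C = t by rewrite normR_real gtr0_norm.
have /small/(PZ (t%:C)%C) : normR ((t%:C)%C^-1 *: y) < r.
  rewrite normRZ normRV nt mulrC ltr_pdivrMr// /t mulrCA mulfV ?gt_eqF//; lra.
rewrite scalerA mulfV// scale1r nt; apply: P_le.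
have -> : 4 * (D + 1) / r * normR y = t * (2 * (D + 1)) by rewrite /t; ring.
by rewrite ler_pM2l//; lra.
Qed.

End Gauge.

(** * Bounded operators and their iterates *)

Section Operators.
Variables (R : realType) (Y : normedModType R[i]).
Implicit Types (S : bounded_operator Y).

Lemma op_bound_ge0 S : exists2 K : R, 0 <= K & forall y, normR (S y) <= K * normR y.
Proof.
have [K SK] := op_bounded S; exists `|K| => // y.
by apply: (le_trans (SK y)); rewrite ler_wpM2r ?normR_ge0// ler_norm.
Qed.

Lemma op_cvg S u y : u @ \oo --> y -> (fun n => S (u n)) @ \oo --> S y.
Proof.
move=> uy; have [K K0 SK] := op_bound_ge0 S.
apply: (@cvg_normR_squeeze _ _ _ _ (fun n => K * normR (u n - y))).
  by move=> n; rewrite -linearB; apply: SK.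
rewrite -[X in _ --> X](mulr0 K) -(@normR0 _ Y) -(subrr y).
by apply: cvgMr; apply: cvg_normR; apply: cvgB => //; apply: cvg_cst.
Qed.

Lemma op_series S (u : nat -> Y) n : S (series u n) = series (fun k => S (u k)) n.
Proof. by rewrite !seriesEnat/= linear_sum. Qed.

(** The iterates are bundled as bounded operators, so that what is known of
    linear and continuous maps applies to them. *)
Definition iter_fun S n : Y -> Y := iter n S.

Fact iter_linear S n : linear (iter_fun S n).
Proof.
move=> a x y; rewrite /iter_fun; elim: n => //= n ->; exact: linearP.
Qed.

HB.instance Definition _ S n :=
  GRing.isLinear.Build R[i] Y Y *:%R (iter_fun S n) (iter_linear S n).

Fact iter_bounded S n :
  exists K : R, forall y, normR (iter_fun S n y) <= K * normR y.
Proof.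
have [K K0 SK] := op_bound_ge0 S; exists (K ^+ n) => y; rewrite /iter_fun.
elim: n => [|n IH] /=; first by rewrite expr0 mul1r.
by apply: (le_trans (SK _)); rewrite exprS -mulrA ler_wpM2l.
Qed.

Definition iter_op S n : bounded_operator Y := BoundedOperator (iter_bounded S n).

Lemma iter_opE S n y : iter_op S n y = iter n S y.
Proof. by []. Qed.

End Operators.

(** * Quasinilpotent vectors and operators *)

Section NthRoots.
Variables (R : realType) (a : nat -> R).
Hypothesis a_ge0 : forall n, 0 <= a n.

(** Trading n-th roots for geometric bounds makes the quasinilpotence conditions
    stable under sums and accessible to uniform boundedness. *)
Lemma root_cvg0P :
  (fun n => a n `^ n%:R^-1) @ \oo --> (0 : R) <->
  forall e : R, 0 < e -> exists C, forall n, a n <= C * e ^+ n.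
Proof.
split=> [a0 e e0|aC].
  have /cvgrPdist_lt/(_ e e0)[N _ Na] := a0.
  pose b k := a k / e ^+ k; have b0 k : 0 <= b k.
    by rewrite divr_ge0// exprn_ge0// ltW.
  (* The sum takes care of the finitely many n for which the root may exceed e. *)
  exists (1 + \sum_(0 <= k < N.+1) b k) => n.
  have en : 0 < e ^+ n by rewrite exprn_gt0.
  have [Nn|nN] := ltnP N n.
    have := Na n (ltnW Nn); rewrite /= sub0r normrN ger0_norm ?powR_ge0// => ane.
    have -> : a n = (a n `^ n%:R^-1) ^+ n.
      have n0 : n%:R != 0 :> R by rewrite pnatr_eq0; case: (n) Nn.
      by rewrite -powR_mulrn ?powR_ge0// -powRrM mulVf// powRr1.
    apply: (@le_trans _ _ (e ^+ n)).
      by apply: lerXn2r; rewrite ?nnegrE ?powR_ge0// ltW.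
    by apply: ler_peMl; [exact: ltW|rewrite lerDl sumr_ge0].
  rewrite -ler_pdivrMr// big_mkord (bigD1 (Ordinal (nN : (n < N.+1)%N)))//=.
  rewrite addrCA -/(b n) lerDl addr_ge0// sumr_ge0//.
apply/cvgrPdist_lt => e e0; have e20 : 0 < e / 2 by lra.
(* The ratio e / 2 leaves a factor 2^-n, which absorbs the constant C. *)
have [C Ca] := aC _ e20.
have [|N CN] := @geometric_small _ 2^-1 C 1 _ ltr01; first by lra.
exists N.+1 => // n /= Nn; have n0 : n%:R != 0 :> R by rewrite pnatr_eq0; case: (n) Nn.
rewrite sub0r normrN ger0_norm ?powR_ge0//.
have -> : e = (e ^+ n) `^ n%:R^-1 by rewrite -powR_mulrn ?ltW// -powRrM mulfV// powRr1// ltW.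
apply: gt0_ltr_powR; rewrite ?nnegrE//.
- by rewrite invr_gt0 lt_def n0 ler0n.
- by rewrite exprn_ge0// ltW.
apply: (le_lt_trans (Ca n)); rewrite exprMn mulrCA -[ltRHS]mulr1.
by rewrite ltr_pM2l ?exprn_gt0// CN// ltnW.
Qed.

End NthRoots.

Section QuasinilpotentPart.
Variables (R : realType) (Y : normedModType R[i]).
Implicit Types (S : bounded_operator Y).

Lemma quasinilpotent_partP S y : quasinilpotent_part S y <->
  forall e : R, 0 < e -> exists C, forall n, normR (iter n S y) <= C * e ^+ n.
Proof. by apply: root_cvg0P => n; exact: normR_ge0. Qed.

Lemma quasinilpotent_part_submod S :
  submod_closed [pred y | y \in quasinilpotent_part S].
Proof.
split=> [|a x y].
  apply/mem_set/quasinilpotent_partP => e e0; exists 0 => n.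
  by rewrite -iter_opE linear0 normR0 mul0r.
move=> /set_mem/quasinilpotent_partP Hx /set_mem/quasinilpotent_partP Hy.
apply/mem_set/quasinilpotent_partP => e e0.
have [[C xC] [D yD]] := (Hx e e0, Hy e e0).
exists (normR a * C + D) => n; rewrite -iter_opE linearP.
rewrite (le_trans (normRD _ _))// normRZ mulrDl lerD//; last exact: yD.
by rewrite -mulrA ler_wpM2l ?normR_ge0//; exact: xC.
Qed.

Lemma quasinilpotent_part_invariant S y :
  quasinilpotent_part S y -> quasinilpotent_part S (S y).
Proof.
move=> /quasinilpotent_partP Hy; apply/quasinilpotent_partP => e e0.
have [C yC] := Hy e e0; exists (C * e) => n.
by rewrite -iterSr -mulrA -exprS; exact: yC.
Qed.

Lemma kernel_quasinilpotent_part S y : S y = 0 -> quasinilpotent_part S y.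
Proof.
move=> Sy0; apply/quasinilpotent_partP => e e0; exists (normR y) => -[|n].
  by rewrite expr0 mulr1.
rewrite iterSr Sy0 -iter_opE linear0 normR0.
by rewrite mulr_ge0 ?normR_ge0 ?exprn_ge0 ?ltW.
Qed.

Lemma op_norm_has_sup S :
  has_sup [set normR (S y) | y in [set y | normR y <= 1]].
Proof.
split; first by exists (normR (S 0)), 0 => //=; rewrite normR0.
have [K K0 SK] := op_bound_ge0 S; exists K => _ [y /= y1 <-].
by rewrite (le_trans (SK y))// -[leRHS]mulr1 ler_wpM2l.
Qed.

Lemma op_norm_ge0 S : 0 <= op_norm S.
Proof.
apply: (le_trans (normR_ge0 (S 0))); apply: sup_upper_bound.
  exact: op_norm_has_sup.
by exists 0 => //=; rewrite normR0.
Qed.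

Lemma le_op_norm S y : normR (S y) <= op_norm S * normR y.
Proof.
have [->|/eqP/normR_gt0 y0] := eqVneq y 0; first by rewrite linear0 normR0 mulr0.
pose t : R[i] := ((normR y)%:C)%C.
have nt : normR t = normR y by rewrite normR_real gtr0_norm.
have tC0 : t != 0 by apply/eqP => /complexI t0; rewrite t0 ltxx in y0.
have -> : S y = t *: S (t^-1 *: y) by rewrite linearZ scalerA mulfV// scale1r.
rewrite normRZ nt mulrC ler_wpM2r ?normR_ge0//.
apply: sup_upper_bound; first exact: op_norm_has_sup.
by exists (t^-1 *: y) => //=; rewrite normRZ normRV nt mulVf ?gt_eqF.
Qed.

Lemma op_norm_le S (K : R) :
  (forall y, normR (S y) <= K * normR y) -> 0 <= K -> op_norm S <= K.
Proof.
move=> SK K0; apply: ge_sup; first by have [] := op_norm_has_sup S.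
move=> _ [y /= y1 <-].
by rewrite (le_trans (SK y))// -[leRHS]mulr1 ler_wpM2l.
Qed.

Lemma quasinilpotentP S : quasinilpotent S <->
  forall e : R, 0 < e -> exists C, forall n y,
    normR (iter n S y) <= C * e ^+ n * normR y.
Proof.
have -> : quasinilpotent S <-> forall e : R, 0 < e ->
    exists C, forall n, op_norm (iter_op S n) <= C * e ^+ n.
  by apply: root_cvg0P => n; exact: (op_norm_ge0 (iter_op S n)).
split=> H e e0; have [C CS] := H e e0.
  exists C => n y; apply: (le_trans (le_op_norm (iter_op S n) y)).
  by rewrite ler_wpM2r ?normR_ge0.
exists `|C| => n; apply: op_norm_le => [y|]; last first.
  by rewrite mulr_ge0// exprn_ge0// ltW.
apply: (le_trans (CS n y)); rewrite ler_wpM2r ?normR_ge0//.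
by rewrite ler_wpM2r ?ler_norm// exprn_ge0// ltW.
Qed.

Lemma quasinilpotent_pointwise S y : quasinilpotent S -> quasinilpotent_part S y.
Proof.
move=> /quasinilpotentP qS; apply/quasinilpotent_partP => e /qS[C Cn].
by exists (C * normR y) => n; rewrite mulrAC; exact: Cn.
Qed.

End QuasinilpotentPart.

(** * Uniform boundedness and open mapping *)

Section BanachOperators.
Variables (R : realType) (Y : completeNormedModType R[i]).
Implicit Types (S : bounded_operator Y).

(** Uniform boundedness of the operators S^n / e^n: the gauge_bounded lemma is
    applied to the seminorm sup_n |S^n y| / e^n, finite by assumption. *)
Lemma pointwise_quasinilpotent S :
  (forall y, quasinilpotent_part S y) -> quasinilpotent S.
Proof.
move=> Sq; apply/quasinilpotentP => e e0.
have en0 n : 0 < e ^+ n by rewrite exprn_gt0.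
suff [C C0 CS] : exists2 C : R, 0 < C &
    forall y n, normR (iter n S y) <= (C * normR y) * e ^+ n.
  by exists C => n y; rewrite mulrAC.
apply: (@gauge_bounded _ _ (fun c y => forall n, normR (iter n S y) <= c * e ^+ n)).
- by move=> c d y cd Sy n; rewrite (le_trans (Sy n))// ler_wpM2r// ltW.
- move=> c d x y Sx Sy n; rewrite -iter_opE linearB mulrDl.
  by rewrite (le_trans (normRB _ _))// lerD//; [exact: Sx|exact: Sy].
- move=> a c y Sy n; rewrite -iter_opE linearZ normRZ -mulrA.
  by rewrite ler_wpM2l ?normR_ge0//; exact: Sy.
- by move=> y; have /quasinilpotent_partP/(_ e e0) := Sq y.
move=> c u y Su uy n; apply: (cvg_normR_le (op_cvg (S := iter_op S n) uy)).
apply: nearW => N; rewrite op_series seriesEnat/=.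
have c0 : 0 <= c.
  by have := le_trans (normR_ge0 _) (Su 0%N 0%N); rewrite !expr0 !mulr1.
rewrite (le_trans (normR_sum _ (fun k => iter n S (u k))))//.
apply: (@le_trans _ _ (c * e ^+ n * \sum_(0 <= k < N) 2^-1 ^+ k)).
  by rewrite mulr_sumr ler_sum_nat// => k _; rewrite mulrAC.
have -> : 2 * c * e ^+ n = c * e ^+ n * (2^-1 ^+ 0 / (1 - 2^-1)) by field.
apply: ler_wpM2l; first by rewrite mulr_ge0// ltW.
by apply: geometric_sum_le; lra.
Qed.

(** Open mapping: the quotient seminorm inf {|x| : S x = y} on the Banach space
    range S is countably subadditive because Y is complete. *)
Lemma closed_range_lift S : closed (range S) ->
  exists2 C : R, 0 < C &
    forall y, range S y -> exists2 x, S x = y & normR x <= C * normR y.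
Proof.
move=> cS.
have sS : submod_closed [pred y | y \in range S].
  split=> [|a _ _ /set_mem[x _ <-] /set_mem[y _ <-]]; apply/mem_set.
    by exists 0 => //; rewrite linear0.
  by exists (a *: x + y) => //; rewrite linearP.
pose W := ClosedSubspace sS cS.
suff [C C0 CW] : exists2 C : R, 0 < C & forall w : subspace_type W,
    exists2 x, S x = val w & normR x <= C * normR w.
  exists C => // y Sy; have yW : y \in subspace_set W by apply/mem_set.
  exact: (CW (Sub y yW)).
apply: (@gauge_bounded _ _ (fun c (w : subspace_type W) =>
  exists2 x, S x = val w & normR x <= c)).
- by move=> c d w cd [x Sx xc]; exists x => //; apply: le_trans cd.
- move=> c d w v [x Sx xc] [y Sy yd]; exists (x - y).
    by rewrite [LHS]linearB [RHS]raddfB; congr (_ - _).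
  by rewrite (le_trans (normRB _ _))// lerD.
- move=> a c w [x Sx xc]; exists (a *: x); first by rewrite [LHS]linearZ [RHS]linearZ Sx.
  by rewrite normRZ ler_wpM2l ?normR_ge0.
- by move=> w; have [x _ Sx] := set_mem (valP w); exists (normR x), x.
move=> c u w Su uw.
have [x xS xc] : exists2 x : nat -> Y, (forall k, S (x k) = val (u k)) &
    forall k, normR (x k) <= c * 2^-1 ^+ k.
  have /choice[x xP] : forall k, exists x, S x = val (u k) /\ normR x <= c * 2^-1 ^+ k.
    by move=> k; have [x] := Su k; exists x.
  by exists x => k; have [] := xP k.
have [|y xy yc] := series_geometric_cvg _ xc; first by lra.
exists y; last by have -> : 2 * c = c / (1 - 2^-1) by field.
apply: (cvg_unique (norm_hausdorff (V := Y)) (op_cvg (S := S) xy)).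
have -> : (fun n => S (series x n)) = (fun n => val (series u n)).
  apply/funext => n; rewrite op_series /series /=.
  rewrite (big_morph (fun w : subspace_type W => val w) (id1 := 0) (op1 := +%R)) //.
  by apply: eq_bigr => k _; rewrite xS.
apply/cvg_normRP => e; have /cvg_normRP := uw; exact.
Qed.

(** Such an operator is bounded below, so its iterates cannot decrease the norm
    of a nonzero vector faster than geometrically. *)
Lemma injective_quasinilpotent_part S : closed (range S) -> injective S ->
  forall y, quasinilpotent_part S y -> y = 0.
Proof.
move=> /closed_range_lift[C C0 CS] Sinj y /quasinilpotent_partP Sy.
have Sn n : normR y <= C ^+ n * normR (iter n S y).
  elim: n => [|n IH]; first by rewrite expr0 mul1r.
  apply: (le_trans IH); rewrite exprSr -mulrA.
  apply: ler_wpM2l; first by rewrite exprn_ge0// ltW.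
  have [|x /Sinj -> //] := CS (S (iter n S y)).
  by exists (iter n S y).
have [K yK] : exists K, forall n, normR (iter n S y) <= K * (C^-1 / 2) ^+ n.
  by apply: Sy; rewrite divr_gt0 ?invr_gt0.
apply: normR_eq0; apply/eqP; rewrite eq_le normR_ge0 andbT.
apply/ler_addgt0Pr => e e0; rewrite add0r; have [n Kn] := half_exp_small K e0.
apply: (le_trans (Sn n)); apply: le_trans (ltW Kn).
have -> : K * 2^-1 ^+ n = C ^+ n * (K * (C^-1 / 2) ^+ n).
  by rewrite mulrCA -exprMn mulrA mulfV ?gt_eqF// mul1r.
by rewrite ler_wpM2l// exprn_ge0// ltW.
Qed.

End BanachOperators.

(** * Power series and analytic functions *)

Section PowerSeries.
Variables (R : realType) (Y : normedModType R[i]).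
Implicit Types (a : nat -> Y) (w z h : R[i]).

Lemma series_geometric_lim (u : nat -> Y) (y : Y) (c q : R) (N : nat) :
    0 <= q < 1 -> (forall k, normR (u k) <= c * q ^+ k) ->
    series u @ \oo --> y ->
  normR (y - series u N) <= c * q ^+ N / (1 - q).
Proof.
move=> q01 uc uy; apply: (@cvg_normR_le _ _ (fun n => series u n - series u N)).
  by apply: cvgB => //; apply: cvg_cst.
by exists N => // n /= Nn; apply: series_geometric_tail.
Qed.

Lemma cvg_unique_normR (u : nat -> Y) (x y : Y) :
  u @ \oo --> x -> u @ \oo --> y -> x = y.
Proof. exact: (cvg_unique (norm_hausdorff (V := Y))). Qed.

Lemma pseries_coef_bound a w (l : Y) : w <> 0 ->
    series (fun n => w ^+ n *: a n) @ \oo --> l ->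
  exists C, forall n, normR (a n) <= C * (normR w)^-1 ^+ n.
Proof.
move=> /normR_gt0 w0 /cvg_normRP/(_ 1 ltr01)[N Nl].
pose b k := normR (w ^+ k *: a k); have b0 k : 0 <= b k := normR_ge0 _.
exists (2 + \sum_(0 <= k < N) b k) => n.
have -> : normR (a n) = b n * (normR w)^-1 ^+ n.
  by rewrite /b normRZ normRX exprVn mulrAC mulfV ?mul1r// expf_neq0// gt_eqF.
apply: ler_wpM2r; first by rewrite exprn_ge0// invr_ge0 normR_ge0.
have S0 : 0 <= \sum_(0 <= k < N) b k by rewrite sumr_ge0.
have [Nn|nN] := leqP N n.
  have := Nl _ Nn; have := Nl _ (leqW Nn).
  rewrite /series/= big_nat_recr//= -/(b n).
  set s := \sum_(0 <= k < n) _ => s1 s2.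
  have -> : b n = normR ((s + w ^+ n *: a n - l) - (s - l)).
    by rewrite opprB addrA subrK addrAC subrr add0r.
  by have := normRB (s + w ^+ n *: a n - l) (s - l); lra.
apply: (@le_trans _ _ (\sum_(0 <= k < N) b k)); last by lra.
by rewrite big_mkord (bigD1 (Ordinal nN))//= lerDl sumr_ge0.
Qed.

(** Principle of isolated zeros. If a n is the first nonzero coefficient, then at
    a zero w of the sum the term w^n a n is balanced by the tail, which is
    O(|w|^(n+1)); hence |a n| = O(|w|), for zeros w arbitrarily close to 0. *)
Lemma pseries_identity a (f : R[i] -> Y) (r : R) : 0 < r ->
    (forall w, normR w < r -> series (fun n => w ^+ n *: a n) @ \oo --> f w) ->
    (forall e : R, 0 < e -> exists w, [/\ w <> 0, normR w < e & f w = 0]) ->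
  forall n, a n = 0.
Proof.
move=> r0 af f0.
have [C [rho [rho0 aC]]] : exists C rho : R, 0 < rho /\
    forall n, normR (a n) <= C * rho ^+ n.
  have [w [w0 wr _]] := f0 r r0.
  have [C aC] := pseries_coef_bound w0 (af w wr).
  by exists C, (normR w)^-1; rewrite invr_gt0; split=> //; exact: normR_gt0.
have C0 : 0 <= C.
  by have := aC 0%N; rewrite expr0 mulr1; apply: le_trans (normR_ge0 _).
elim/ltn_ind => n IH; apply: normR_eq0; apply/eqP.
rewrite eq_le normR_ge0 andbT; apply/ler_addgt0Pr => e e0; rewrite add0r.
(* For rho |w| <= 1/2 the tail after rank n is at most
   2 C (rho |w|)^(n+1); the summand 1 only makes D positive. *)
pose D := 2 * C * rho ^+ n.+1 + 1.
have D0 : 0 < D.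
  by rewrite ltr_pwDr// mulr_ge0 ?exprn_ge0 ?mulr_ge0// ltW.
have [|w [w0 wd fw0]] := f0 (Num.min r (Num.min (e / D) (rho^-1 / 2))).
  by rewrite !lt_min r0 !divr_gt0// invr_gt0.
move: wd; rewrite !lt_min => /and3P[wr we wrho].
have w_gt0 := normR_gt0 w0.
pose q := rho * normR w.
have q0 : 0 < q by rewrite mulr_gt0.
have q2 : q <= 2^-1.
  rewrite /q mulrC -ler_pdivlMr//; move: wrho; rewrite mulrC => /ltW; exact.
have uq k : normR (w ^+ k *: a k) <= C * q ^+ k.
  by rewrite normRZ normRX exprMn mulrA [leLHS]mulrC ler_wpM2r ?exprn_ge0 ?normR_ge0.
have q01 : 0 <= q < 1 by rewrite ltW//=; lra.
have := series_geometric_lim n.+1 q01 uq (af w wr).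
rewrite fw0 sub0r normRN /series/= big_nat_recr//= big_nat big1; last first.
  by move=> k /andP[_ kn]; rewrite IH// scaler0.
rewrite add0r normRZ normRX => wa.
have wn0 : 0 < normR w ^+ n by rewrite exprn_gt0.
have {}wa : normR w ^+ n * normR (a n) <= normR w ^+ n * (D * normR w).
  apply: (le_trans wa); rewrite ler_pdivrMr; last by lra.
  rewrite /q exprMn (exprSr (normR w)) mulrA.
  rewrite [leLHS](_ : _ = normR w ^+ n * (C * rho ^+ n.+1 * normR w)); last by ring.
  rewrite -2![leRHS]mulrA ler_wpM2l ?(ltW wn0)//.
  rewrite -/q [leRHS](_ : _ = (D * (1 - q)) * normR w); last by ring.
  rewrite ler_wpM2r ?normR_ge0//.
  apply: (@le_trans _ _ (D * 2^-1)).
    by rewrite /D; lra.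
  by rewrite ler_pM2l//; lra.
move: wa; rewrite ler_pM2l// => /le_trans; apply.
by rewrite mulrC -ler_pdivlMr// ltW.
Qed.

Lemma pseries0 w : series (fun n => w ^+ n *: (0 : Y)) @ \oo --> (0 : Y).
Proof.
rewrite (_ : series _ = fun=> 0); first exact: cvg_cst.
by apply/funext => n; rewrite /series/= big1// => k _; rewrite scaler0.
Qed.

Lemma analytic_on_local (U : set R[i]) (f : R[i] -> Y) z :
    analytic_on U f -> U z ->
  exists a (r : R), 0 < r /\
    forall h, normR h < r -> series (fun n => h ^+ n *: a n) @ \oo --> f (z + h).
Proof.
move=> Uf /Uf[a /nbhs_normRP[r r0 ra]]; exists a, r; split=> // h hr.
have := ra (z + h); rewrite addrAC subrr add0r; exact.
Qed.

Lemma analytic_isolated_zeros (U : set R[i]) (f : R[i] -> Y) z :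
    analytic_on U f -> U z ->
    (forall e : R, 0 < e -> exists w, [/\ w <> z, normR (w - z) < e & f w = 0]) ->
  \forall w \near z, f w = 0.
Proof.
move=> Uf /(analytic_on_local Uf)[a [r [r0 ra]]] f0.
have a0 : forall n, a n = 0.
  apply: (pseries_identity r0 ra) => e /f0[w [wz we fw]].
  exists (w - z); split=> //; last by rewrite addrC subrK.
  by move=> wz0; apply: wz; apply/eqP; rewrite -subr_eq0 wz0.
apply/nbhs_normRP; exists r => // w /ra; rewrite (addrC z) subrK => fw.
apply: cvg_unique_normR fw _; under [fun n => _]funext do rewrite a0.
exact: pseries0.
Qed.

(** Identity theorem: the points around which f vanishes form an open set, and
    also a closed subset of U since the zeros accumulate at its limit points. *)
Lemma analytic_identity (U : set R[i]) (f : R[i] -> Y) z :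
  connected U -> analytic_on U f -> U z -> (\forall w \near z, f w = 0) ->
  forall w, U w -> f w = 0.
Proof.
move=> cU Uf Uz fz; pose V : set R[i] := [set w : R[i] | \forall x \near w, f x = 0].
suff UV : U `&` V = U by rewrite -UV => w [_ /nbhs_singleton].
apply: cU; first by exists z.
  exists V => //; rewrite openE => w /= Vw; exact: (near_join Vw).
exists (closure V); first exact: closed_closure.
apply/seteqP; split=> w [Uw Vw]; split=> //; first exact: subset_closure.
apply: (analytic_isolated_zeros Uf Uw) => e e0.
have /Vw[v [Vv ve]] : nbhs w [set x | normR (x - w) < e].
  by apply/nbhs_normRP; exists e.
(* A zero different from w is needed; when v = w, move slightly inside the disc
   around v on which f vanishes. *)
have [vw|vw] := pselect (v = w); last first.
  by exists v; split=> //; exact: nbhs_singleton Vv.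
move: Vv => /nbhs_normRP[r r0 rf].
pose t : R := Num.min r e / 2.
have t0 : 0 < t by rewrite divr_gt0// lt_min r0.
have [tr te] : t < r /\ t < e.
  have [? ?] : Num.min r e <= r /\ Num.min r e <= e by rewrite !ge_min !lexx orbT.
  by rewrite /t; split; lra.
have nt : normR (t%:C)%C = t by rewrite normR_real gtr0_norm.
exists (w + (t%:C)%C); split.
- move=> /(congr1 (fun x => x - w)); rewrite addrAC subrr add0r => tC.
  by move: t0; rewrite -nt tC normR0 ltxx.
- by rewrite addrAC subrr add0r nt.
- by apply: rf; rewrite vw addrAC subrr add0r nt.
Qed.

End PowerSeries.

(** * SVEP at 0 and injectivity *)

Section InjectiveSvep.
Variables (R : realType) (Y : normedModType R[i]) (S : bounded_operator Y).

(** Comparing coefficients in z f z = S (f z) gives S (a 0) = 0 and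
    S (a n.+1) = a n, so all the a n vanish when S is injective. *)
Lemma injective_svep : injective S -> svep_at S 0.
Proof.
move=> Sinj U oU cU U0 f Uf fS; apply: (analytic_identity cU Uf U0).
have [a [r [r0 ra]]] := analytic_on_local Uf U0.
have [r' r'0 r'U] : exists2 r : R, 0 < r & forall z, normR (z - 0) < r -> U z.
  by apply/nbhs_normRP; apply: open_nbhs_nbhs.
(* The coefficients of z f z - S (f z). *)
pose b n := (if n is m.+1 then a m else 0) - S (a n).
have bE w n : series (fun k => w ^+ k *: b k) n.+1 =
    w *: series (fun k => w ^+ k *: a k) n - S (series (fun k => w ^+ k *: a k) n.+1).
  rewrite op_series /series/= [X in _ = X - _]scaler_sumr.
  elim: n => [|n IH].
    by rewrite [X in _ = X - _]big_geq// !big_nat1 /b !sub0r !expr0 !scale1r.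
  rewrite big_nat_recr//= IH [X in _ = X - _]big_nat_recr//=.
  rewrite [X in _ = _ - X]big_nat_recr//= /b scalerBr linearZ/=.
  by rewrite [in RHS]opprD [in RHS]scalerA -exprS addrACA scalerN [in RHS]linearZ.
have b0 : forall n, b n = 0.
  apply: (@pseries_identity _ _ b (fun=> 0) (Num.min r r')) => [|w|e e0].
  - by rewrite lt_min r0.
  - rewrite lt_min => /andP[wr wr'].
    have aw := ra w wr; rewrite add0r in aw.
    have aw1 : (fun n => series (fun k => w ^+ k *: a k) n.+1) @ \oo --> f w.
      by rewrite (@cvg_shiftS _ (series (fun k => w ^+ k *: a k)) (nbhs (f w))).
    rewrite -(@cvg_shiftS _ (series _) (nbhs (0 : Y)))/=.
    under [fun n => _]funext do rewrite bE.
    rewrite -(fS w); last by apply: r'U; rewrite subr0.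
    by apply: cvgB; [apply: cvgZl_tmp|apply: op_cvg].
  - exists ((e / 2)%:C)%C; split=> //.
      by move=> /complexI; lra.
    by rewrite normR_real gtr0_norm; lra.
have a0 : forall n, a n = 0.
  elim=> [|n IH]; apply: Sinj; rewrite linear0; apply/eqP.
    by have /eqP := b0 0%N; rewrite /b sub0r oppr_eq0.
  by have /eqP := b0 n.+1; rewrite /b IH sub0r oppr_eq0.
apply/nbhs_normRP; exists r => // w; rewrite subr0 => /ra; rewrite add0r => fw.
apply: cvg_unique_normR fw _; under [fun n => _]funext do rewrite a0.
exact: pseries0.
Qed.

End InjectiveSvep.

Section Taylor.
Variable R : realType.

Lemma sum_binomial (K : comNzRingType) (x y : K) (N n : nat) : (n < N)%N ->
  \sum_(0 <= k < N) x ^+ (n - k) * y ^+ k *+ 'C(n, k) = (x + y) ^+ n.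
Proof.
move=> nN; rewrite (big_cat_nat (n := n.+1))//= [X in _ + X]big_nat_cond.
rewrite [X in _ + X]big1 ?addr0; first by rewrite big_mkord exprDn.
by move=> k; rewrite andbT => /andP[nk _]; rewrite bin_small.
Qed.

Lemma sum_binomial_le (x y : R) (N n : nat) : 0 <= x -> 0 <= y ->
  \sum_(0 <= k < N) x ^+ (n - k) * y ^+ k *+ 'C(n, k) <= (x + y) ^+ n.
Proof.
move=> x0 y0; rewrite -(@sum_binomial _ x y (N + n.+1)) ?leq_addl//.
rewrite [leRHS](big_cat_nat (n := N)) ?leq_addr//= lerDl sumr_ge0// => k _.
by rewrite mulrn_wge0// mulr_ge0// exprn_ge0.
Qed.

Variables (Y : completeNormedModType R[i]) (u : nat -> Y) (f : R[i] -> Y).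
Variables (A C : R).
Hypothesis C0 : 0 < C.
Hypothesis uC : forall n, normR (u n) <= A * C ^+ n.

(** Re-expansion of a power series around z0: the k-th coefficient is the sum
    over n of 'C(n, k) z0^(n-k) u n. The radius is a quarter of 1 / C so that
    |z0| + |h| stays below 1 / (2 C); then the double series over (n, k) is
    dominated by A 2^-n and the summations can be exchanged. *)
Lemma pseries_analytic :
    (forall z : R[i], normR z < (4 * C)^-1 ->
      series (fun n => z ^+ n *: u n) @ \oo --> f z) ->
  analytic_on [set z | normR z < (4 * C)^-1] f.
Proof.
set r := (4 * C)^-1 => uf z0 /= z0r.
have r0 : 0 < r by rewrite invr_gt0 mulr_gt0.
have A0 : 0 <= A.
  by have := uC 0%N; rewrite expr0 mulr1; apply: le_trans (normR_ge0 _).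
have half01 : 0 <= (2^-1 : R) < 1 by lra.
have rC : (r + r) * C = 2^-1.
  by rewrite /r; field; rewrite gt_eqF.
have small x y : 0 <= x -> x <= r -> 0 <= y -> y <= r ->
    forall n, (x + y) ^+ n * (A * C ^+ n) <= A * 2^-1 ^+ n.
  move=> x0 xr y0 yr n; rewrite mulrCA -exprMn ler_wpM2l//.
  apply: lerXn2r; rewrite ?nnegrE ?mulr_ge0 ?addr_ge0 ?invr_ge0 ?(ltW C0)//.
  by rewrite -rC ler_wpM2r ?lerD// ltW.
pose c (h : R[i]) n k : R[i] := z0 ^+ (n - k) * h ^+ k *+ 'C(n, k).
have nc h n k : normR (c h n k) = normR z0 ^+ (n - k) * normR h ^+ k *+ 'C(n, k).
  rewrite /c -(mulr_natr (_ * _)) !normRM !normRX -[in RHS]mulr_natr; congr (_ * _).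
  by rewrite -(rmorph_nat (real_complex R)) normR_real ger0_norm.
(* The binomial expansion of (z0 + h)^n cut below degree N in h. It is complete for
   n < N, and for all n bounded by (|z0| + |h|)^n. *)
pose D h N n : R[i] := \sum_(0 <= k < N) c h n k.
have nD h N n : normR h <= r -> normR (D h N n *: u n) <= A * 2^-1 ^+ n.
  move=> hr; rewrite normRZ.
  apply: le_trans (small _ _ (normR_ge0 z0) (ltW z0r) (normR_ge0 h) hr n).
  apply: ler_pM; rewrite ?normR_ge0//.
  apply: (le_trans (normR_sum _ _)); under eq_bigr do rewrite nc.
  by rewrite sum_binomial_le ?normR_ge0.
have rCE : normR (r%:C)%C = r by rewrite normR_real gtr0_norm.
have /choice[b bP] k : exists b : Y,
    series (fun n => (z0 ^+ (n - k) *+ 'C(n, k)) *: u n) @ \oo --> b.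
  have [n|b ub _] := @series_geometric_cvg _ Y
      (fun n => (z0 ^+ (n - k) *+ 'C(n, k)) *: u n) (A / r ^+ k) 2^-1 half01.
    rewrite mulrAC ler_pdivlMr ?exprn_gt0//.
    have -> : normR ((z0 ^+ (n - k) *+ 'C(n, k)) *: u n) * r ^+ k =
        normR (c (r%:C)%C n k *: u n).
      by rewrite !normRZ mulrAC -{1}rCE -normRX -normRM mulrnAl.
    rewrite normRZ.
    apply: le_trans (small _ _ (normR_ge0 z0) (ltW z0r) (ltW r0) (lexx r) n).
    apply: ler_pM; rewrite ?normR_ge0// nc rCE.
    have := @sum_binomial_le (normR z0) r k.+1 n (normR_ge0 z0) (ltW r0).
    rewrite big_nat_recr//=; apply: le_trans; rewrite lerDr sumr_ge0// => j _.
    by rewrite mulrn_wge0// mulr_ge0 ?exprn_ge0 ?normR_ge0// ltW.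
  by exists b.
exists b; apply/nbhs_normRP; exists (r - normR z0); first by rewrite subr_gt0.
move=> z; set h := z - z0 => hr.
have hr' : normR h <= r by have := normR_ge0 z0; lra.
have zE : z = z0 + h by rewrite /h addrC subrK.
have zr : normR z < r by rewrite zE (le_lt_trans (normRD _ _))//; lra.
have DN N : series (fun n => D h N n *: u n) @ \oo -->
    series (fun k => h ^+ k *: b k) N.
  have -> : series (fun n => D h N n *: u n) = (fun m => \sum_(0 <= k < N)
      h ^+ k *: series (fun n => (z0 ^+ (n - k) *+ 'C(n, k)) *: u n) m).
    apply/funext => m; rewrite /series/=.
    under [RHS]eq_bigr do rewrite scaler_sumr.
    rewrite [RHS]exchange_big/=; apply: eq_bigr => n _.
    rewrite /D scaler_suml; apply: eq_bigr => k _.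
    by rewrite scalerA mulrnAr mulrC.
  rewrite /series/=; elim: N => [|N IH].
    rewrite big_geq//; under [fun m => _]funext do rewrite big_geq//.
    exact: cvg_cst.
  rewrite big_nat_recr//=; under [fun m => _]funext do rewrite big_nat_recr//=.
  by apply: cvgD => //; apply: cvgZl_tmp; apply: bP.
(* The N-th partial sums of the two expansions are respectively the sum and the
   N-th partial sum of one series, with terms D h N n *: u n. *)
have close N : normR (series (fun k => h ^+ k *: b k) N -
    series (fun n => z ^+ n *: u n) N) <= A * 2^-1 ^+ N / (1 - 2^-1).
  have -> : series (fun n => z ^+ n *: u n) N = series (fun n => D h N n *: u n) N.
    rewrite /series/= !big_nat; apply: eq_bigr => n /andP[_ nN].
    by rewrite /D sum_binomial// -zE.
  by apply: series_geometric_lim (DN N) => // n; apply: nD.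
rewrite -[X in _ --> X](subrK (f z)) subrr add0r.
have -> : series (fun n => h ^+ n *: b n) = (fun N =>
    (series (fun k => h ^+ k *: b k) N - series (fun n => z ^+ n *: u n) N) +
    series (fun n => z ^+ n *: u n) N).
  by apply/funext => N; rewrite subrK.
rewrite -[f z]add0r; apply: cvgD; last exact: uf.
apply/cvg_normRP => e e0.
have [N Ne] := geometric_small (A / (1 - 2^-1)) half01 e0.
exists N => n Nn; rewrite subr0; apply: (le_lt_trans (close n)).
by rewrite mulrAC; exact: Ne.
Qed.

End Taylor.

Section SvepInjective.
Variable R : realType.

Lemma open_disc (r : R) : open [set z : R[i] | normR z < r].
Proof.
rewrite openE => z /= zr; apply/nbhs_normRP; exists (r - normR z).
  by rewrite subr_gt0.
by move=> w wz /=; have := normRD (w - z) z; rewrite subrK; lra.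
Qed.

(** The disc is a union of segments issued from 0. *)
Lemma connected_disc (r : R) : connected [set z : R[i] | normR z < r].
Proof.
have [r0|r0] := leP r 0.
  rewrite (_ : mkset _ = set0); first exact: connected0.
  by apply/seteqP; split=> z //=; have := normR_ge0 z; lra.
have -> : [set z : R[i] | normR z < r] =
    \bigcup_(z in [set z : R[i] | normR z < r])
      ((fun t : R => (t%:C)%C * z) @` `[0, 1]).
  apply/seteqP; split=> [z zr|x [z /= zr [t]]].
    exists z => //; exists 1; last by rewrite mul1r.
    by rewrite /= in_itv/= ler01 lexx.
  rewrite /= in_itv/= => /andP[t0 t1] <-; rewrite /= normRM normR_real ger0_norm//.
  by apply: le_lt_trans zr; rewrite ler_piMl// normR_ge0.
apply: bigcup_connected => [|z _].
  exists 0 => z _; exists 0; last by rewrite mul0r.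
  by rewrite /= in_itv/= ler01 lexx.
apply: connected_continuous_connected; first exact: segment_connected.
apply: continuous_subspaceT => t A /nbhs_normRP[e e0 eA].
have ze : 0 < e / (normR z + 1) by rewrite divr_gt0// ltr_wpDl ?normR_ge0.
suff : \forall s \near t, A ((s%:C)%C * z) by [].
near=> s; apply: eA; rewrite -mulrBl -rmorphB normRM normR_real.
have : `|s - t| < e / (normR z + 1).
  by rewrite distrC; near: s; apply: cvgr_dist_lt.
rewrite ltr_pdivlMr; last by rewrite ltr_wpDl ?normR_ge0.
by apply: le_lt_trans; rewrite ler_wpM2l// lerDl.
Unshelve. all: by end_near. Qed.

Variables (Y : completeNormedModType R[i]) (S : bounded_operator Y).

(** A nonzero kernel vector x extends to a backward orbit u of S with geometric
    growth, whose generating function is a nonzero solution of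
    (z - S) f z = 0 near 0. *)
Lemma svep_injective : semi_regular S -> svep_at S 0 -> injective S.
Proof.
move=> [cS kerS] svepS; suff ker0 : forall x, S x = 0 -> x = 0.
  by move=> v w Svw; apply/eqP; rewrite -subr_eq0; apply/eqP/ker0; rewrite linearB Svw subrr.
move=> x Sx0; have [C C0 lift] := closed_range_lift cS.
have /choice[g gP] : forall y, exists x, range S y -> S x = y /\ normR x <= C * normR y.
  move=> y; have [/lift[w Sw wC]|ny] := pselect (range S y); first by exists w.
  by exists 0.
pose u n := iter n g x.
have kerU n : iter n.+1 S (u n) = 0.
  elim: n => //= n IH; rewrite -iterS iterSr.
  by have [|-> _] := gP (u n); [apply: (kerS n.+1)|].
have Su n : S (u n.+1) = u n by have [|->] := gP (u n); [apply: (kerS n.+1)|].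
have nu n : normR (u n) <= normR x * C ^+ n.
  elim: n => [|n IH]; first by rewrite expr0 mulr1.
  have [|_ gC] := gP (u n); first exact: (kerS n.+1).
  apply: (le_trans gC); rewrite exprS mulrCA ler_wpM2l// ltW//.
pose r := (4 * C)^-1; have r0 : 0 < r by rewrite invr_gt0 mulr_gt0.
have /choice[f fP] : forall z : R[i], exists y : Y, normR z < r ->
    series (fun n => z ^+ n *: u n) @ \oo --> y.
  move=> z; have [zr|] := boolP (normR z < r); last by exists 0.
  have [||y uy _] := @series_geometric_cvg _ Y (fun n => z ^+ n *: u n)
      (normR x) (normR z * C).
  - rewrite mulr_ge0 ?normR_ge0 ?(ltW C0)//= -ltr_pdivlMr//.
    apply: (lt_trans zr); rewrite /r mul1r ltf_pV2 ?posrE ?mulr_gt0//.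
    by rewrite ltr_pMl//; lra.
  - move=> k; rewrite normRZ normRX exprMn mulrCA.
    by rewrite ler_wpM2l ?exprn_ge0 ?normR_ge0.
  by exists y.
have f0 : f 0 = x.
  have /fP uf : normR (0 : R[i]) < r by rewrite normR0.
  apply: (cvg_unique_normR uf); rewrite -(@cvg_shiftS _ (series _) (nbhs x))/=.
  rewrite (_ : (fun n => _) = fun=> x); first exact: cvg_cst.
  apply/funext => n; rewrite /series/= big_nat_recl//= expr0 scale1r.
  by rewrite big1 ?addr0// => k _; rewrite expr0n/= scale0r.
have disc0 : normR (0 : R[i]) < r by rewrite normR0.
have f_an := pseries_analytic C0 nu fP.
rewrite -f0; have := svepS _ (@open_disc r) (@connected_disc r) disc0 f f_an.
apply => // z zr.
have uf := fP z zr; apply/eqP; rewrite subr_eq0; apply/eqP.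
  have zf : (fun n => z *: series (fun k => z ^+ k *: u k) n) @ \oo --> z *: f z.
    exact: cvgZl_tmp.
  apply: (cvg_unique_normR zf).
have Sf := op_cvg (S := S) uf.
rewrite -(@cvg_shiftS _ (fun n => S _) (nbhs (S (f z))))/= in Sf.
rewrite (_ : (fun n => _) = (fun n => S (series (fun k => z ^+ k *: u k) n.+1)))//.
apply/funext => n; rewrite op_series /series/= big_nat_recl//= linearZ/= Sx0.
  rewrite scaler0 add0r scaler_sumr; apply: eq_bigr => k _.
  by rewrite [in RHS]linearZ/= (Su k) scalerA exprS.
Qed.

End SvepInjective.

(** * Restrictions, and the equivalence *)

Section Restrictions.
Variables (R : realType) (X : normedModType R[i]) (T : bounded_operator X).
Variables (M : closed_subspace X) (TM : Defs.invariant T M).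

Lemma val_iter_restr n (u : subspace_type M) :
  val (iter n (restr TM) u) = iter n T (val u).
Proof. by elim: n => //= n ->. Qed.

Lemma quasinilpotent_part_restr (u : subspace_type M) :
  quasinilpotent_part (restr TM) u <-> quasinilpotent_part T (val u).
Proof.
have nu n : normR (iter n (restr TM) u) = normR (iter n T (val u)).
  by rewrite -val_iter_restr.
by split=> /quasinilpotent_partP H; apply/quasinilpotent_partP => e /H[C uC];
  exists C => n; have := uC n; rewrite nu.
Qed.

(** M is closed, so closedness of a subset of M does not depend on whether it is
    tested in M or in X. *)
Lemma closed_range_restr : closed (range (restr TM)) <-> closed (T @` M).
Proof.
split=> /closed_normRP cl; apply/closed_normRP => x xcl.
  have Mx : subspace_set M x.
    have /closed_normRP := @subspace_closed _ _ M; apply=> e /xcl[y [z Mz <-] yx].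
    by exists (T z) => //; apply: TM; exists z.
  have [|u _ /(congr1 val) /= ux] := cl (Sub x (mem_set Mx) : subspace_type M).
    move=> e /xcl[_ [z Mz <-] yx].
    exists (restr TM (Sub z (mem_set Mz))); last exact: yx.
    by exists (Sub z (mem_set Mz)).
  by exists (val u) => //; exact: set_mem (valP u).
have [|z Mz zx] := cl (val x).
  move=> e /xcl[_ [z _ <-] zx]; exists (T (val z)); last exact: zx.
  by exists (val z) => //; exact: set_mem (valP z).
by exists (Sub z (mem_set Mz)) => //; apply: val_inj.
Qed.

End Restrictions.

Theorem theorem3p1 (R : realType) (X : completeNormedModType R[i])
    (infX : ~ finite_dimensional X) (T : bounded_operator X) :
  left_generalized_Drazin_invertible T <->
  exists D : generalized_Kato_decomposition T,
    svep_at (restr (gkd_invM D)) 0.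
Proof.
split=> [[cH [M [MH TM cTM]]]|[[M N MN TM TN [cM kM] qN] /= svepM]].
  pose N := ClosedSubspace (quasinilpotent_part_submod T) cH.
  have TN : Defs.invariant T N by move=> _ [x Nx <-]; exact: quasinilpotent_part_invariant.
  have Sinj : injective (restr TM).
    move=> u v uv; apply/eqP; rewrite -subr_eq0; apply/eqP/val_inj.
    have : (M `&` quasinilpotent_part T) (val (u - v)); last by rewrite MH.2.
    split; first exact: set_mem (valP (u - v)).
    apply/(quasinilpotent_part_restr TM)/kernel_quasinilpotent_part.
    by rewrite linearB uv subrr.
  have srM : semi_regular (restr TM).
    split=> [|n u]; first exact/closed_range_restr.
    rewrite /null_space/= => nu; exists 0 => //; rewrite linear0.
    elim: n nu => //= n IH; rewrite -[X in _ = X](linear0 (restr TM)).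
    by move=> /Sinj/IH.
  have qN : quasinilpotent (restr TN).
    apply: pointwise_quasinilpotent => u; apply/quasinilpotent_part_restr.
    exact: set_mem (valP u).
  by exists (@GKD _ _ _ M N MH TM TN srM qN); exact: injective_svep.
have Sinj : injective (restr TM) by apply: svep_injective => //; split.
have NH x : subspace_set N x -> quasinilpotent_part T x.
  move=> Nx; have /quasinilpotent_part_restr :=
    quasinilpotent_pointwise (Sub x (mem_set Nx) : subspace_type N) qN.
  exact.
have HN : quasinilpotent_part T = N.
  (* The component a of x along M is a difference of quasinilpotent vectors. *)
  apply/seteqP; split=> [x Hx|x /NH//]; have [a [b [Ma Nb xab]]] := MN.1 x.
  have Ha : quasinilpotent_part T a.
    have [_ /(_ (-1) b x (mem_set (NH _ Nb)) (mem_set Hx))/set_mem] :=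
      quasinilpotent_part_submod T.
    by rewrite xab scaleN1r addrCA addNr addr0.
  have /(congr1 val)/= a0 : (Sub a (mem_set Ma) : subspace_type M) = 0.
    by apply: (injective_quasinilpotent_part cM Sinj); apply/quasinilpotent_part_restr.
  by rewrite xab a0 add0r.
rewrite /left_generalized_Drazin_invertible HN; split.
  exact: subspace_closed.
by exists M; split=> //; exact/closed_range_restr.
Qed.
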